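(* Let $d, k$ be positive integers, let $f = (f_1, \dots, f_k) : \mathbb{R}^d \to \mathbb{R}^k$ be differentiable, let $x \in \mathbb{R}^d$, let $c \in \operatorname*{arg\,max}_{1 \le i \le k} f_i(x)$, and let $j \in \{1, \dots, k\}$ with $j \neq c$. Let $w \in \mathbb{R}^d$ have nonnegative entries, and put $R(w) = [-w_1, w_1] \times [-w_2, w_2] \times \cdots \times [-w_d, w_d]$. Then the constraint $$f_c(x + r) \ge f_j(x + r) \quad \text{for all } r \in R(w)$$ is equivalent to $$\mathbb{E}_t\left[\max\{0,\, f_j(x + t \odot w) - f_c(x + t \odot w)\}\right] \le 0,$$ where $\mathbb{E}_t$ denotes the expectation over $t$ uniformly distributed on $[-1,1]^d$.
   Context: The symbol $\odot$ denotes the element-wise product: $(t \odot w)_i = t_i w_i$ for $i = 1, \dots, d$. The function $f$ is a classification model with $k$ categories, assumed differentiable with respect to its input; $x$ is a fixed input and $c$ is the category assigned to $x$, i.e. an index maximizing $f_i(x)$ over $i$. *)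

(* Defs.v *)
From HB Require Import structures.
From mathcomp Require Import all_boot all_order all_algebra.
From mathcomp Require Import all_classical all_reals all_analysis.

Set Implicit Arguments.
Unset Strict Implicit.
Unset Printing Implicit Defensive.

Import Order.TTheory GRing.Theory Num.Theory.
Import numFieldNormedType.Exports.

Local Open Scope classical_set_scope.
Local Open Scope ring_scope.

Section power_prob.
Context d (T : measurableType d) (R : realType).

Definition cons_pair n (x : T * n.-tuple T) : n.+1.-tuple T :=
  [tuple of x.1 :: x.2].

Lemma measurable_cons_pair n : measurable_fun setT (@cons_pair n).
Proof. exact: measurable_cons. Qed.

HB.instance Definition _ n :=
  isMeasurableFun.Build _ _ _ _ (@cons_pair n) (@measurable_cons_pair n).

(* The n-fold product P \x ... \x P, carried to n.-tuple T along
   T * (T * (... * unit)) ~ n.-tuple T: the law of n i.i.d. draws from P. *)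
Fixpoint power_prob (P : probability T R) n : probability (n.-tuple T) R :=
  if n is m.+1 return probability (n.-tuple T) R
  then distribution (P \x power_prob P m)%E (@cons_pair m)
  else \d_[tuple].

Lemma power_prob_rect (P : probability T R) n (A : 'I_n -> set T) :
  (forall i, measurable (A i)) ->
  power_prob P n [set t | forall i, A i (tnth t i)] = (\prod_(i < n) P (A i))%E.
Proof.
elim: n A => [|n IHn] A mA.
  by rewrite big_ord0 /= diracE mem_set// => -[].
rewrite big_ord_recl -IHn// /= /distribution /pushforward.
have mB : measurable [set t : n.-tuple T | forall i, A (lift ord0 i) (tnth t i)].
  rewrite (_ : mkset _ = \bigcap_(i in [set: 'I_n])
      (setT `&` (@tnth n T ^~ i) @^-1` A (lift ord0 i))); last first.
    by apply/seteqP; split => t /= + i => /(_ i) //; rewrite setTI => /(_ I).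
  apply: fin_bigcap_measurable => // i _.
  exact: measurable_tnth.
rewrite -product_measure1E//; congr (_ _).
apply/seteqP; split => -[x t] /=.
  by move=> At; split=> [|i]; [have := At ord0|have := At (lift ord0 i)];
    rewrite ?tnthS ?tnth0.
move=> [Ax At] i; case: (unliftP ord0 i) => [j|] ->.
  by rewrite tnthS.
by rewrite tnth0.
Qed.

End power_prob.

Lemma ltrN11 (R : realType) : -1 < 1 :> R.
Proof. by rewrite (lt_trans (@ltrN10 R)). Qed.

Definition uniform_cube (R : realType) n :
    probability (n.-tuple (measurableTypeR R)) R :=
  power_prob (uniform_prob (ltrN11 R)) n.

(* A box contained in the cube has probability vol(box) / vol([-1, 1]^n). *)
Lemma uniform_cube_box (R : realType) n (a b : 'I_n -> R) :
  (forall i, -1 <= a i <= b i /\ b i <= 1) ->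
  uniform_cube R n [set t | forall i, tnth t i \in `[a i, b i]] =
  ((\prod_(i < n) (b i - a i)) / 2 ^+ n)%:E.
Proof.
move=> ab.
have mI i : measurable (`[a i, b i]%classic : set (measurableTypeR R)) by [].
rewrite [LHS](power_prob_rect (uniform_prob (ltrN11 R)) mI).
rewrite -[n in 2 ^+ n]card_ord -prodr_const -prodf_div.
rewrite -prodEFin; apply: eq_bigr => i _.
have [/andP[a1 lab] b1] := ab i.
rewrite /= /uniform_prob integral_uniform_pdf setIidl; last first.
  move=> x /=; rewrite !in_itv/= => /andP[ax xb].
  by rewrite (le_trans a1)// (le_trans xb).
rewrite (eq_integral (fun=> (1 - -1)^-1%:E)); last first.
  move=> x; rewrite inE/= in_itv/= => /andP[ax xb].
  by rewrite /uniform_pdf (le_trans a1)//= (le_trans xb).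
rewrite integral_cst//= lebesgue_measure_itv/= lte_fin opprK.
case: ltgtP lab => // [_ _|-> _]; last by rewrite subrr mul0r mule0.
by rewrite -EFinD -EFinM mulrC.
Qed.

Definition row_of_tuple (R : realType) n (t : n.-tuple R) : 'rV[R]_n :=
  \row_i tnth t i.

Definition hadamard (R : realType) n (t w : 'rV[R]_n) : 'rV[R]_n :=
  map2_mx *%R t w.

Definition box (R : realType) n (w : 'rV[R]_n) : set 'rV[R]_n :=
  [set r | forall i, r 0 i \in `[- w 0 i, w 0 i]].

(* Main.v *)
(* The map t |-> t (.) w sends [-1, 1]^d onto R(w), and the cube has full
   measure, so the constraint makes the integrand vanish almost everywhere.
   Conversely, a violation at r = t (.) w persists, by continuity, with a
   uniform positive margin on a small box around t clipped to the cube; that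
   box has positive probability, so the expectation is positive. *)

Require Import Defs.
From mathcomp Require Import all_boot all_order all_algebra.
From mathcomp Require Import all_classical all_reals all_analysis.
From mathcomp Require Import lra measurable_realfun.

Import Order.TTheory GRing.Theory Num.Theory.
Import numFieldNormedType.Exports.
Import HBNNSimple.

Local Open Scope classical_set_scope.
Local Open Scope ring_scope.

(* The integral of a nonnegative function is by definition the supremum of the
   integrals of the simple functions below it, so the integrand
   need not be measurable. *)
Lemma integral_le0_conull d (T : measurableType d) (R : realType)
    (mu : {measure set T -> \bar R}) (A : set T) (g : T -> R) :
  measurable A -> mu (~` A) = 0%E -> (forall t, 0 <= g t) ->
  (forall t, A t -> g t = 0) -> (\int[mu]_t (g t)%:E <= 0)%E.
Proof.
move=> mA muA0 g0 gA0; rewrite ge0_integralTE; last first.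
  by move=> t; rewrite lee_fin.
apply: ge_ereal_sup => _ [h /= hg <-]; rewrite -integralT_nnsfun.
rewrite (ge0_negligible_integral _ _ _ _ muA0)//.
- rewrite setDE setTI setCK integral0_eq// => t At.
  by apply: le_anti; have := hg t; rewrite gA0// => ->; rewrite lee_fin fun_ge0.
- exact: measurableC.
- exact/measurable_EFinP.
- by move=> t _; rewrite lee_fin fun_ge0.
Qed.

(** The simple function equal to [e] on [A] and 0 elsewhere lies below [g], so its integral
    [e * mu A > 0] bounds that of [g] from below. *)
Lemma integral_gt0_ge_cst d (T : measurableType d) (R : realType)
    (mu : {measure set T -> \bar R}) (A : set T) (e : R) (g : T -> R) :
  measurable A -> (0 < mu A)%E -> 0 < e -> (forall t, 0 <= g t) ->
  (forall t, A t -> e <= g t) -> (0 < \int[mu]_t (g t)%:E)%E.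
Proof.
move=> mA muA e0 g0 gAe; pose h := scale_nnsfun (indic_nnsfun R mA) (ltW e0).
apply: (@lt_le_trans _ _ (e%:E * mu A)%E); first exact: mule_gt0.
rewrite ge0_integralTE; last by move=> t; rewrite lee_fin.
apply: ereal_sup_ubound; exists h => [t|] /=.
  rewrite lee_fin /= mindicE; case: (boolP (t \in A)) => [|_].
    by rewrite inE mulr1 => /gAe.
  by rewrite mulr0.
by rewrite sintegralrM sintegral_indic.
Qed.

Lemma measurable_box_tuple (R : realType) n (a b : 'I_n -> R) :
  measurable [set t : n.-tuple (measurableTypeR R) |
    forall i, tnth t i \in `[a i, b i]].
Proof.
rewrite (_ : mkset _ = \bigcap_(i in [set: 'I_n])
    (setT `&` (@tnth n (measurableTypeR R) ^~ i) @^-1` `[a i, b i])).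
  apply: fin_bigcap_measurable => // i _.
  exact: measurable_tnth.
apply/seteqP; split => t /= + i => /(_ i) //.
by rewrite setTI => /(_ I).
Qed.

(** The law lives on all tuples of reals; the box formula with every side equal to [-1, 1] gives the
    cube probability 1. *)
Lemma uniform_cube_compl (R : realType) n :
  uniform_cube R n (~` [set t | forall i, tnth t i \in `[-1, 1]]) = 0%E.
Proof.
rewrite probability_setC; last exact: measurable_box_tuple.
rewrite uniform_cube_box; last by move=> i; rewrite !lexx ltW// ltrN11.
rewrite prodr_const card_ord opprK divff ?expf_neq0 ?pnatr_eq0//.
by rewrite subee.
Qed.

Lemma uniform_cube_neighborhood (R : realType) n (t : 'I_n -> R) (e : R) :
  (forall i, t i \in `[-1, 1]) -> 0 < e ->
  exists A, [/\ measurable A, (0 < uniform_cube R n A)%E &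
    forall s, A s -> forall i, `|t i - tnth s i| <= e].
Proof.
move=> t1 e0.
(* Clipping to [-1, 1] makes the box formula applicable; each side keeps positive length even when
   [t i] is an endpoint. *)
pose a i := Num.max (-1) (t i - e); pose b i := Num.min 1 (t i + e).
have ab i : -1 <= a i < b i /\ b i <= 1.
  have := t1 i; rewrite in_itv/= => /andP[t1l t1r].
  rewrite /a /b le_max lexx/= ge_min lexx lt_min !gt_max ltrN11/=.
  by split=> //; lra.
exists [set s : n.-tuple (measurableTypeR R) |
  forall i, tnth s i \in `[a i, b i]]; split.
- exact: measurable_box_tuple.
- rewrite uniform_cube_box; last first.
    by move=> i; have [/andP[-> /ltW->] ->] := ab i.
  rewrite lte_fin divr_gt0 ?exprn_gt0// prodr_gt0// => i _.
  by rewrite subr_gt0; have [/andP[]] := ab i.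
- move=> s As i; have := As i.
  rewrite in_itv/= ge_max le_min ler_distl => /andP[/andP[_ ?] /andP[_ ?]].
  by apply/andP; split; lra.
Qed.

Lemma box_hadamard (R : realType) n (w : 'rV[R]_n) (t : n.-tuple R) :
  (forall i, 0 <= w 0 i) -> (forall i, tnth t i \in `[-1, 1]) ->
  box w (hadamard (row_of_tuple t) w).
Proof.
move=> w0 t1 i; have := t1 i; rewrite !mxE !in_itv/= => /andP[tl tr].
by rewrite -mulN1r ler_wpM2r//= ler_piMl.
Qed.

(** To be applied to G(r) = f_j(x + r) - f_c(x + r), of which only continuity matters. *)
Lemma box_le0_expectation (R : realType) n (G : 'rV[R]_n -> R) (w : 'rV[R]_n) :
  continuous G -> (forall i, 0 <= w 0 i) ->
  (forall r, box w r -> G r <= 0) <->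
  ('E_(uniform_cube R n)[fun t : n.-tuple R =>
      (Num.max 0 (G (hadamard (row_of_tuple t) w)))%R] <= 0)%E.
Proof.
move=> cG w0; rewrite unlock; split=> [Gle0|E0 r wr].
  apply: (@integral_le0_conull _ _ _ _
    [set t : n.-tuple (measurableTypeR R) | forall i, tnth t i \in `[-1, 1]]).
  - exact: measurable_box_tuple.
  - exact: uniform_cube_compl.
  - by move=> t; rewrite le_max lexx.
  - by move=> t t1; apply/max_idPl/Gle0/box_hadamard.
rewrite leNgt; apply/negP => Gr0; move: E0; apply/negP; rewrite -ltNge.
have : \forall y \near r, G r / 2 < G y.
  apply: (cvgr_gt _ (cG r)).
  by rewrite ltr_pdivrMr// ltr_pMr// ltr1n.
move=> /nbhs_ballP[e /= e0 reG].
(* [M] strictly dominates every [w 0 i] and is positive even if [w] is zero, so moving [t] by at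
   most [e / M] in each coordinate moves [t i * w 0 i] by strictly less than [e]. *)
pose M := 1 + \sum_i w 0 i.
have wM i : w 0 i < M.
  rewrite /M (bigD1 i)//= addrCA ltrDl.
  by rewrite ltr_pwDl// sumr_ge0.
have M0 : 0 < M by rewrite ltr_pwDl// sumr_ge0.
(* When w_i = 0 the convention x / 0 = 0 picks the value 0. *)
pose t i := r 0 i / w 0 i.
have tw i : t i * w 0 i = r 0 i.
  rewrite /t; have [wi0|wi0] := eqVneq (w 0 i) 0; last by rewrite divfK.
  (* A zero weight collapses the side of the box to a point, forcing [r 0 i = 0]. *)
  have := wr i; rewrite wi0 oppr0 mulr0 in_itv/= => /le_anti.
  by move->.
have t1 i : t i \in `[-1, 1].
  rewrite /t; have [wi0|wi0] := eqVneq (w 0 i) 0.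
    by rewrite wi0 invr0 mulr0 in_itv/= lerN10 ler01.
  have wi : 0 < w 0 i by rewrite lt_neqAle eq_sym wi0 w0.
  have := wr i.
  by rewrite !in_itv/= ler_pdivlMr// ler_pdivrMr// mulN1r mul1r.
have [A [mA A0 tA]] := @uniform_cube_neighborhood _ _ t _ t1 (divr_gt0 e0 M0).
apply: (@integral_gt0_ge_cst _ _ _ _ A (G r / 2)) => //.
- exact: divr_gt0.
- by move=> s; rewrite le_max lexx.
move=> s As; rewrite le_max; apply/orP; right; apply: ltW; apply: reG; split=> // i' i.
(* Balls of row vectors are defined entrywise, so one coordinate at a time suffices. *)
rewrite (ord1 i') /= /ball/= !mxE -tw -mulrBl normrM (ger0_norm (w0 i)).
apply: (@le_lt_trans _ _ (e / M * w 0 i)).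
  by rewrite ler_wpM2r// tA.
by rewrite mulrAC ltr_pdivrMr// ltr_pM2l.
Qed.

Lemma continuous_translate (R : realType) (V W : normedModType R) (f : V -> W)
  (x : V) : (forall y, differentiable f y) -> continuous (fun r => f (x + r)).
Proof.
move=> df r; apply: (@continuous_comp _ _ _ (fun r => x + r) f).
  by apply: cvgD; [exact: cvg_cst|exact: cvg_id].
exact/differentiable_continuous/df.
Qed.

Theorem proposition3p1 (R : realType) (d k : nat) (d_gt0 : (0 < d)%N)
    (k_gt0 : (0 < k)%N) (f : 'rV[R]_d -> 'rV[R]_k)
    (f_diff : forall y : 'rV[R]_d, differentiable f y)
    (x : 'rV[R]_d) (c : 'I_k) (c_argmax : forall i : 'I_k, f x 0 i <= f x 0 c)
    (j : 'I_k) (j_neq_c : j != c)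
    (w : 'rV[R]_d) (w_ge0 : forall i : 'I_d, 0 <= w 0 i) :
  (forall r : 'rV[R]_d, box w r -> f (x + r) 0 j <= f (x + r) 0 c) <->
  ('E_(uniform_cube R d)[fun t : d.-tuple R =>
      (Num.max 0 (f (x + hadamard (row_of_tuple t) w) 0 j
                  - f (x + hadamard (row_of_tuple t) w) 0 c))%R] <= 0)%E.
Proof.
(* Differentiability of [f] yields continuity of the gap between the scores of [j] and [c]. *)
have cG : continuous (fun r => f (x + r) 0 j - f (x + r) 0 c).
  have cf i : continuous (fun r => f (x + r) 0 i).
    move=> r; apply: (@continuous_comp _ _ _ (fun r => f (x + r))
      (fun v : 'rV[R]_k => v 0 i)); first exact: continuous_translate.
    exact: coord_continuous.
  by move=> r; exact: (cvgB (cf j r) (cf c r)).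
have boxE := box_le0_expectation _ _ _ _ cG w_ge0.
by split=> [fle|/boxE fle r /fle]; [apply/boxE => r /fle|]; rewrite subr_le0.
Qed.
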